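(* Let $w$ be a non-empty finite word with heart $v$. Then $w$ is a GT-word if and only if $|w| = R_v + K_v + |\mathrm{Alph}(w)| - 2$.
   Context: Words are finite sequences of letters; $|w|$ is the length of $w$ and $\mathrm{Alph}(w)$ the set of letters occurring in $w$. A factor of $w$ is a contiguous subword (the empty word included). The factor complexity $C_w(n)$ is the number of distinct factors of $w$ of length $n$ ($n\ge 0$); set $C_w(n)=0$ for $n>|w|$. A factor $u$ of $w$ is right special if $ux$ is a factor of $w$ for at least two distinct letters $x$. $R_w$ denotes the smallest positive integer $r$ such that $w$ has no right special factor of length $r$, and $K_w$ denotes the length of the shortest suffix of $w$ that occurs exactly once in $w$. A word $w$ with $|\mathrm{Alph}(w)|\ge 2$ is a generalized trapezoidal word (GT-word) if there exist positive integers $m\le M$ such that $C_w(0)=1$, $C_w(i)=|\mathrm{Alph}(w)|+i-1$ for $1\le i\le m$, $C_w(i+1)=C_w(i)$ for $m\le i\le M-1$, and $C_w(i+1)=C_w(i)-1$ for $M\le i\le |w|$. In addition, every non-empty word $w$ with $|\mathrm{Alph}(w)|=1$ is also considered a GT-word. Heart: for a non-empty word $w$, let $r$ be the longest (possibly empty) prefix of $w$ such that every letter of $r$ occurs exactly once in $w$, and $s$ the longest (possibly empty) suffix of $w$ such that every letter of $s$ occurs exactly once in $w$. If $|w|>|\mathrm{Alph}(w)|$, the heart of $w$ is the unique non-empty word $v$ with $w=rvs$; if $|w|=|\mathrm{Alph}(w)|$, the heart of $w$ is $w$ itself. *)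

(* Defs.v *)
From mathcomp Require Import all_boot.

Set Implicit Arguments.
Unset Strict Implicit.
Unset Printing Implicit Defensive.

Section Words.

Variable T : eqType.
Implicit Types (u v w : seq T) (n i k r : nat) (x y : T).

Definition alph w : seq T := undup w.

(* The factors of w of length n, without repetition; there are none when
   n > size w, since then (size w).+1 - n = 0. *)
Definition factors w n : seq (seq T) :=
  undup [seq take n (drop i w) | i <- iota 0 ((size w).+1 - n)].

Lemma mem_factors w n u : (u \in factors w n) = (size u == n) && infix u w.
Proof.
rewrite mem_undup; apply/mapP/andP => [[i]|[/eqP <- /infixP[p [s ->]]]].
  rewrite mem_iota add0n /= => lt_i ->; split.
    have le_ni : n + i <= size w by rewrite -ltnS -ltn_subRL.
    by rewrite size_takel // size_drop leq_subRL // (leq_trans _ le_ni) ?leq_addl // addnC.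
  apply/infixP; exists (take i w), (drop n (drop i w)).
  by rewrite !cat_take_drop.
exists (size p); last by rewrite drop_size_cat // take_size_cat.
by rewrite mem_iota add0n /= !size_cat ltn_subRL ltnS addnCA leq_add2l leq_addr.
Qed.

Definition complexity w n : nat := size (factors w n).

Definition right_special w u : bool :=
  has (fun x => has (fun y =>
    [&& x != y, infix (rcons u x) w & infix (rcons u y) w]) w) w.

Lemma right_specialP w u :
  reflect (exists x y, [/\ x != y, infix (rcons u x) w & infix (rcons u y) w])
          (right_special w u).
Proof.
have in_w x : infix (rcons u x) w -> x \in w.
  by move=> /mem_infix; apply; rewrite mem_rcons mem_head.
apply: (iffP hasP) => [[x _ /hasP[y _ /and3P[]]]|[x [y [xy ux uy]]]].
  by exists x, y.
by exists x; [exact: in_w|apply/hasP; exists y; [exact: in_w|exact/and3P]].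
Qed.

Definition no_right_special w r : bool :=
  ~~ has (right_special w) (factors w r).

Lemma ex_no_right_special w : exists r, (0 < r) && no_right_special w r.
Proof.
exists (size w).+1; rewrite /no_right_special /=.
by rewrite /factors subnn.
Qed.

(* R_w *)
Definition Rindex w : nat := ex_minn (ex_no_right_special w).

(* The number of positions of w at which u occurs. *)
Definition occurrences u w : nat :=
  count (fun i => prefix u (drop i w)) (iota 0 (size w).+1).

Definition suffix_of_length w k : seq T := drop (size w - k) w.

Lemma ex_unrepeated_suffix w :
  exists k, (k <= size w) && (occurrences (suffix_of_length w k) w == 1).
Proof.
exists (size w); rewrite leqnn /suffix_of_length subnn drop0 /occurrences /=.
rewrite drop0 prefix_refl /= eqSS -leqn0 leqNgt -has_count.
apply/hasPn => i; rewrite mem_iota add1n => /andP[i_gt0 le_i].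
apply/negP => /size_prefix; rewrite size_drop leqNgt ltn_subrL i_gt0 /=.
by move: le_i; rewrite ltnS => le_i; rewrite (leq_trans i_gt0).
Qed.

(* K_w *)
Definition Kindex w : nat := ex_minn (ex_unrepeated_suffix w).

Definition occurs_once w x : bool := count_mem x w == 1.

Definition heart_prefix w : seq T :=
  take (find (predC (occurs_once w)) w) w.

Definition heart_suffix w : seq T :=
  rev (take (find (predC (occurs_once w)) (rev w)) (rev w)).

Definition heart w : seq T :=
  if size (alph w) < size w then
    take (size w - size (heart_prefix w) - size (heart_suffix w))
         (drop (size (heart_prefix w)) w)
  else w.

Fact all_prefix_find (a : pred T) w k : k <= size w ->
  all a (take k w) = (k <= find (predC a) w).
Proof.
elim: w k => [|x w IHw] [|k] //=.
by rewrite ltnS => /IHw ->; case: (a x).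
Qed.

Lemma heart_prefix_longest w u : prefix u w ->
  all (occurs_once w) u = (size u <= size (heart_prefix w)).
Proof.
move=> pu; have le_u := size_prefix pu.
rewrite size_takel ?find_size // -all_prefix_find //.
by move: pu; rewrite prefixE => /eqP ->.
Qed.

Lemma heart_suffix_longest w u : suffix u w ->
  all (occurs_once w) u = (size u <= size (heart_suffix w)).
Proof.
move=> su; have pu : prefix (rev u) (rev w) by rewrite prefix_rev.
rewrite size_rev size_takel ?find_size // -(size_rev u).
rewrite -all_prefix_find ?size_prefix //.
by move: pu; rewrite prefixE => /eqP ->; rewrite all_rev.
Qed.

Lemma heart_prefix_prefix w : prefix (heart_prefix w) w.
Proof. exact: prefix_take. Qed.

Lemma heart_suffix_suffix w : suffix (heart_suffix w) w.
Proof. by rewrite /suffix revK prefix_take. Qed.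

Lemma heartE w : size (alph w) < size w ->
  w = heart_prefix w ++ heart w ++ heart_suffix w /\ heart w != [::].
Proof.
move=> lt_w; rewrite /heart lt_w.
set p := heart_prefix w; set s := heart_suffix w.
have /hasP[z zw nz] : has (predC (occurs_once w)) w.
  rewrite has_predC; apply/negP => /allP once_w.
  suff uw : uniq w by rewrite /alph undup_id ?ltnn in lt_w.
  by apply/count_mem_uniq => x; have [/once_w/eqP //|/count_memPn ->] := boolP (x \in w).
have pE : prefix p w := heart_prefix_prefix w.
have sE : suffix s w := heart_suffix_suffix w.
have zp : z \notin p.
  have /allP ap : all (occurs_once w) p by rewrite heart_prefix_longest.
  by apply: contra nz => /ap.
have zs : z \notin s.
  have /allP ap : all (occurs_once w) s by rewrite heart_suffix_longest.
  by apply: contra nz => /ap.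
case/prefixP: pE => q wE.
have zq : z \in q by move: zw; rewrite wE mem_cat (negPf zp).
have drop_q : drop (size p) w = q by rewrite wE drop_size_cat.
rewrite drop_q.
have lt_sq : size s < size q.
  rewrite ltnNge; apply/negP => le_qs; case/suffixP: sE => t wE'.
  have /eqP : drop (size w - size q) w = q by rewrite wE size_cat addnK drop_size_cat.
  rewrite {2}wE' drop_cat.
  have -> : (size w - size q < size t) = false.
    by apply/negbTE; rewrite -leqNgt wE' size_cat -addnBA // leq_addr.
  by move=> /eqP qE; move: zq; rewrite -qE => /mem_drop; apply/negP.
have -> : size w - size p - size s = size q - size s by rewrite wE size_cat addKn.
have sqE : drop (size q - size s) q = s.
  rewrite -{2}drop_q drop_drop.
  have -> : size q - size s + size p = size w - size s.
    by rewrite wE size_cat addnC addnBA // ltnW.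
  by case/suffixP: sE => t ->; rewrite size_cat addnK drop_size_cat.
split; first by rewrite -{2}sqE cat_take_drop.
by rewrite -size_eq0 size_takel ?leq_subr // -lt0n subn_gt0.
Qed.

(* The condition C(i+1) = C(i) - 1 is written additively to avoid truncated
   subtraction; in size (alph w) + i - 1 truncation never happens (i >= 1).
   The case size (alph w) = 1 forces w to be non-empty. *)
Definition GT_word w : Prop :=
  size (alph w) = 1 \/
  2 <= size (alph w) /\
  exists m M : nat,
    [/\ 0 < m <= M,
        complexity w 0 = 1,
        forall i, 1 <= i <= m -> complexity w i = size (alph w) + i - 1,
        forall i, m <= i <= M - 1 -> complexity w i.+1 = complexity w i
      & forall i, M <= i <= size w -> complexity w i = complexity w i.+1 + 1].

End Words.

(* Main.v *)
Require Import Defs.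
From mathcomp Require Import all_boot zify.

Set Implicit Arguments.
Unset Strict Implicit.
Unset Printing Implicit Defensive.

(** Let [C], [K], [R] be the complexity function and the two indices of a word
    of length [N] with [k] letters, and let [s n] be the sum of
    (number of right extensions - 1) over the right special factors of length
    [n].  Counting right extensions gives [C (n + 1) + [K <= n] = C n + s n],
    and summing this over [1 <= n <= N] gives [N + 1 = k + K + sum s].  As [s n]
    is positive exactly for [n < R], the equality [N = R + K + k - 2] means that
    [s n <= 1] for all [n >= 1], and this yields the GT shape of [C] with
    [m = min R K] and [M = max R K].

    Conversely, the GT shape forces [s n <= 1] as soon as [m <= K].  The
    inequality [K < m] can only happen if the first or the last letter of the
    word is unrepeated; the heart has no such letter unless all its letters are
    distinct.  Finally, removing an unrepeated letter from an end of a word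
    lowers [C n] by one for all [n] in [1..N], hence preserves the GT shape as
    well as [N - k]. *)

(** * Elementary facts on sums and on lists of distinct elements *)

Lemma sum_geq_nat (a n : nat) :
  \sum_(1 <= i < n.+1) (a <= i : nat) = if a == 0 then n else n.+1 - a.
Proof.
elim: n => [|n IH]; first by rewrite big_geq //; case: a => [|[]].
by rewrite big_nat_recr //= IH; case: ifP => a0; lia.
Qed.

Lemma sum_le1 (I : eqType) (s : seq I) (F : I -> nat) i :
  \sum_(j <- s) F j <= 1 -> i \in s -> F i <= 1.
Proof.
by move=> S si; rewrite (big_rem i) //= in S; lia.
Qed.

Lemma sum_le1_inj (I : eqType) (s : seq I) (F : I -> nat) i j :
  \sum_(k <- s) F k <= 1 -> i \in s -> j \in s -> 0 < F i -> 0 < F j -> i = j.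
Proof.
move=> S si sj Fi Fj; apply/eqP/negPn/negP => ij.
rewrite (big_rem i) //= (big_rem j) /= in S; first by lia.
rewrite rem_mem //; by rewrite eq_sym.
Qed.

Lemma sum_gt1_ex2 (I : eqType) (s : seq I) (F : I -> nat) :
  uniq s -> 1 < \sum_(k <- s) F k -> {in s, forall i, F i <= 1} ->
  exists i j, [/\ i != j, i \in s, j \in s, 0 < F i & 0 < F j].
Proof.
move=> us S F1; have E : \sum_(k <- s) F k = count (fun k => 0 < F k) s.
  rewrite -sum1_count [RHS]big_mkcond; apply: eq_big_seq => i /F1.
  by case: (F i) => [|[]].
rewrite E -size_filter in S.
have H i : i \in [seq k <- s | 0 < F k] -> i \in s /\ 0 < F i.
  by rewrite mem_filter => /andP[].
have := filter_uniq (fun k => 0 < F k) us.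
case: (filter _ _) S H => [|i [|j r]] //= _ H /andP[ir _].
have [si Fi] := H i (mem_head _ _).
have [|sj Fj] := H j; first by rewrite !inE eqxx orbT.
by exists i, j; split=> //; move: ir; rewrite inE negb_or => /andP[].
Qed.

Lemma size_gt1 (I : eqType) (s : seq I) x y :
  x != y -> x \in s -> y \in s -> 1 < size s.
Proof.
move=> xy xs ys; have := @uniq_leq_size _ [:: x; y] s.
rewrite /= inE xy; apply => // z; rewrite !inE => /orP[]/eqP-> //.
Qed.

Lemma size_gt2 (I : eqType) (s : seq I) x y z :
  x != y -> x != z -> y != z -> x \in s -> y \in s -> z \in s -> 2 < size s.
Proof.
move=> xy xz yz xs ys zs; have := @uniq_leq_size _ [:: x; y; z] s.
rewrite /= !inE negb_or xy xz yz; apply => // t.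
by rewrite !inE => /or3P[]/eqP-> //.
Qed.

(** * Right extensions of factors *)

Section Extensions.

Variable T : eqType.
Implicit Types (u v w : seq T) (x y : T) (n : nat).

Definition rexts w u := [seq x <- undup w | infix (rcons u x) w].

(** The truncated [.-1] makes a factor without right extension count 0 instead of -1;
    [complexity_rec] restores this unit through [Kindex w <= n]. *)
Definition surplus w n := \sum_(u <- factors w n) (size (rexts w u)).-1.

Lemma uniq_rexts w u : uniq (rexts w u).
Proof. by rewrite filter_uniq ?undup_uniq. Qed.

Lemma mem_rexts w u x : (x \in rexts w u) = infix (rcons u x) w.
Proof.
rewrite mem_filter mem_undup andb_idr // => /mem_infix; apply.
by rewrite mem_rcons mem_head.
Qed.

Lemma rexts_n0 w u x : infix (rcons u x) w -> rexts w u != [::].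
Proof. by rewrite -mem_rexts; case: (rexts w u). Qed.

Lemma rexts_infix w u : rexts w u != [::] -> infix u w.
Proof.
case E : (rexts w u) => [//|x s] _.
have : x \in rexts w u by rewrite E mem_head.
by rewrite mem_rexts => H; apply: infix_trans H; apply: infix_rcons.
Qed.

Lemma right_specialE w u : right_special w u = (1 < size (rexts w u)).
Proof.
apply/right_specialP/idP => [[x [y [xy ux uy]]]|].
  by apply: (size_gt1 xy); rewrite mem_rexts.
have := uniq_rexts w u; have := mem_rexts w u.
case: (rexts w u) => [|x [|y s]] //= E /andP[xs _] _; exists x, y.
by rewrite -!E !inE !eqxx orbT; move: xs; rewrite inE negb_or => /andP[].
Qed.

Lemma rexts_behead w x u : {subset rexts w (x :: u) <= rexts w u}.
Proof. by move=> y; rewrite !mem_rexts => /consl_infix. Qed.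

Lemma rexts_suffix w u v : suffix u v -> {subset rexts w v <= rexts w u}.
Proof.
case/suffixP=> p ->; elim: p => [|z p IH] // y /rexts_behead; exact: IH.
Qed.

Lemma rexts_ltn w u : rexts w u != [::] -> size u < size w.
Proof.
case E : (rexts w u) => [//|x s] _.
have : x \in rexts w u by rewrite E mem_head.
by rewrite mem_rexts => /size_infix; rewrite size_rcons.
Qed.

Lemma complexityS w n :
  complexity w n.+1 = \sum_(u <- factors w n) size (rexts w u).
Proof.
transitivity (size [seq rcons u x | u <- factors w n, x <- rexts w u]);
  last first.
  by rewrite size_allpairs_dep sumnE big_map.
apply/perm_size/uniq_perm; first exact: undup_uniq.
  apply: allpairs_uniq_dep; first exact: undup_uniq.
    by move=> u _; exact: uniq_rexts.
  by move=> [u x] [v y] _ _ /= /rcons_inj[-> ->].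
move=> z; rewrite mem_factors; apply/idP/allpairsPdep => [/andP[]|].
  case/lastP: z => // u x; rewrite size_rcons eqSS => /eqP un uw.
  exists u, x; rewrite mem_factors mem_rexts un eqxx uw; split=> //=.
  by apply: infix_trans uw; apply: infix_rcons.
case=> u [x []]; rewrite mem_factors mem_rexts => /andP[/eqP <- _] ux ->.
by rewrite size_rcons eqxx.
Qed.

(** * Repeated suffixes, the index K and the recursion for the complexity *)

Lemma size_suffix_of_length w n : n <= size w -> size (suffix_of_length w n) = n.
Proof. by move=> nw; rewrite size_drop subKn. Qed.

Lemma suffix_of_lengthP w u : suffix u w -> suffix_of_length w (size u) = u.
Proof.
by case/suffixP=> p ->; rewrite /suffix_of_length size_cat addnK drop_size_cat.
Qed.

Lemma suffix_suffix_of_length w n : suffix (suffix_of_length w n) w.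
Proof. exact: suffix_drop. Qed.

(** Every occurrence of a suffix other than the final one is followed by a letter. *)
Lemma occurrences_suffix w k : k <= size w ->
  (occurrences (suffix_of_length w k) w == 1)
    = (rexts w (suffix_of_length w k) == [::]).
Proof.
move=> kw; set t := suffix_of_length w k.
have st : size t = k by exact: size_suffix_of_length.
rewrite /occurrences.
(* The positions split into those before the final occurrence, that occurrence, and those with fewer
   than [k] letters left. *)
have -> : (size w).+1 = (size w - k) + k.+1 by lia.
rewrite iotaD count_cat /= add0n -/(suffix_of_length w k) -/t prefix_refl.
have /eqP -> : count (fun i => prefix t (drop i w)) (iota (size w - k).+1 k) == 0.
  rewrite -leqn0 leqNgt -has_count; apply/hasPn => i; rewrite mem_iota => ilt.
  by apply/negP => /size_prefix; rewrite size_drop; lia.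
rewrite addn0 addn1 eqSS -leqn0 leqNgt -has_count -[RHS]negbK; congr (~~ _).
apply/hasP/idP => [[i]|].
  rewrite mem_iota add0n => /andP[_ ilt] /prefixP[r wr].
  have : size (drop i w) = size t + size r by rewrite wr size_cat.
  rewrite size_drop st; case: r wr => [|x r] wr; first by rewrite /=; lia.
  move=> _; apply/eqP => E; have := mem_rexts w t x; rewrite E in_nil.
  move=> /esym/negP[]; apply/infixP; exists (take i w), r.
  by rewrite -[LHS](cat_take_drop i) wr cat_rcons.
case E : (rexts w t) => [//|x s] _.
have : x \in rexts w t by rewrite E mem_head.
rewrite mem_rexts => /infixP[p [q wE]]; exists (size p).
  by rewrite mem_iota wE !size_cat size_rcons; lia.
by rewrite wE drop_size_cat // cat_rcons prefix_prefix.
Qed.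

(** A right extension of a suffix also extends every shorter suffix, so being unrepeated passes to
    longer suffixes. *)
Lemma Kindex_le w n : n <= size w ->
  (Kindex w <= n) = (rexts w (suffix_of_length w n) == [::]).
Proof.
move=> nw; rewrite /Kindex; case: ex_minnP => k /andP[kw ku] kmin.
apply/idP/idP => [kn|E]; last by apply: kmin; rewrite nw occurrences_suffix.
move: ku; rewrite occurrences_suffix // => /eqP E.
case F : (rexts w (suffix_of_length w n)) => [//|x s].
suff : x \in rexts w (suffix_of_length w k) by rewrite E.
apply: (@rexts_suffix _ _ (suffix_of_length w n)); last by rewrite F mem_head.
rewrite /suffix_of_length; have -> : size w - k = n - k + (size w - n) by lia.
by rewrite -drop_drop suffix_drop.
Qed.

Lemma Kindex_leq_size w : Kindex w <= size w.
Proof. by rewrite /Kindex; case: ex_minnP => k /andP[]. Qed.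

Lemma Kindex_gt0 w : w != [::] -> 0 < Kindex w.
Proof.
case: w => // x w _; rewrite ltnNge Kindex_le //; apply/eqP => E.
have := mem_rexts (x :: w) [::] x; rewrite -[in rexts _ _](drop_size (x :: w)).
move: E; rewrite /suffix_of_length subn0 => ->.
by rewrite in_nil infix1s mem_head.
Qed.

Lemma Kindex_gt1 w x : x \in w -> 1 < Kindex (rcons w x).
Proof.
move=> xw; rewrite ltnNge Kindex_le ?size_rcons //.
rewrite /suffix_of_length size_rcons subn1 -cats1 drop_size_cat //.
(* [y] is the letter after the occurrence of [x] found in [w]; when that occurrence ends [w], it is
   the appended [x]. *)
case/splitPr: xw => p q; set y := head x q; apply/eqP => E.
have := mem_rexts ((p ++ x :: q) ++ [:: x]) [:: x] y.
rewrite E in_nil => /esym/negP[]; apply/infixP; exists p.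
rewrite /y; case: q {y E} => [|y q]; [exists [::]|exists (q ++ [:: x])];
  by rewrite -catA.
Qed.

(** The only factor of length [n] that can lack a right extension is the suffix of length [n], and
    it lacks one exactly when [Kindex w <= n]. *)
Lemma complexity_rec w n : n <= size w ->
  complexity w n.+1 + (Kindex w <= n) = complexity w n + surplus w n.
Proof.
move=> nw; rewrite complexityS /surplus.
pose P u := rexts w u == [::].
have -> : (Kindex w <= n) = count P (factors w n) :> nat.
  rewrite Kindex_le //; set t := suffix_of_length w n.
  have tn : size t = n by exact: size_suffix_of_length.
  have tf : t \in factors w n.
    by rewrite mem_factors tn eqxx suffixW // suffix_suffix_of_length.
  transitivity (count (fun u => (u == t) && P t) (factors w n)).
    have [Pt|Pt] := boolP (P t); rewrite /P in Pt; rewrite /P.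
      rewrite Pt (@eq_count _ _ (pred1 t)) => [|u]; last by rewrite /= andbT.
      by rewrite count_uniq_mem ?undup_uniq // tf.
    rewrite (negbTE Pt) (@eq_count _ _ pred0) ?count_pred0 // => u.
    by rewrite /= andbF.
  apply: eq_in_count => u; rewrite mem_factors => /andP[/eqP un /infixP[p [q wE]]].
  rewrite /P; apply/andP/eqP => [[/eqP -> /eqP//]|E].
  case: q wE => [|x q] wE; last first.
    have := mem_rexts w u x; rewrite E in_nil => /esym/negP[].
    by apply/infixP; exists p, q; rewrite cat_rcons.
  suff -> : t = u by rewrite E.
  rewrite /t -un suffix_of_lengthP //; apply/suffixP; exists p.
  by rewrite wE cats0.
rewrite /complexity -sum1_size -sum1_count [X in _ + X]big_mkcond -!big_split /=.
apply: eq_bigr => u _; rewrite /P -size_eq0.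
by case: (size _) => [|k] /=; rewrite ?addn0.
Qed.

Lemma complexity0 w : complexity w 0 = 1.
Proof.
suff E : perm_eq (factors w 0) [:: [::]] by rewrite /complexity (perm_size E).
apply: uniq_perm => //; first exact: undup_uniq.
move=> u; rewrite mem_factors inE size_eq0 andb_idr // => /eqP->; exact: infix0s.
Qed.

Lemma complexity1 w : complexity w 1 = size (alph w).
Proof.
rewrite -(size_map (fun x => [:: x])).
apply/perm_size/uniq_perm; first exact: undup_uniq.
  by rewrite map_inj_uniq ?undup_uniq // => x y [].
move=> u; rewrite mem_factors; apply/andP/mapP => [[]|[x]].
  case: u => [|x [|y u]] // _; rewrite infix1s => xw.
  by exists x => //; rewrite mem_undup.
by rewrite mem_undup => xw ->; rewrite infix1s.
Qed.

Lemma complexity_le w n : complexity w n <= (size w).+1 - n.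
Proof. by rewrite /complexity (leq_trans (size_undup _)) // size_map size_iota. Qed.

Lemma complexity_gt0 w n : n <= size w -> 0 < complexity w n.
Proof.
move=> nw; rewrite /complexity lt0n size_eq0; apply/eqP => E.
have := mem_factors w n (take n w); rewrite E in_nil size_takel // eqxx.
by rewrite prefixW ?prefix_take.
Qed.

Lemma complexity_size_lt w n : size w < n -> complexity w n = 0.
Proof. by move=> wn; have := complexity_le w n; lia. Qed.

Lemma complexity_rev w n : complexity (rev w) n = complexity w n.
Proof.
rewrite /complexity -(size_map rev); apply/perm_size/uniq_perm.
- by rewrite map_inj_uniq ?undup_uniq //; exact: (can_inj revK).
- exact: undup_uniq.
move=> u; rewrite -[u]revK mem_map ?mem_factors; last exact: (can_inj revK).
by rewrite revK size_rev infix_revLR revK.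
Qed.

(** * Right special factors, the index R and the length formula *)

Lemma no_right_specialP w n :
  reflect (forall u, size u = n -> size (rexts w u) <= 1) (no_right_special w n).
Proof.
apply: (iffP hasPn) => [H u un|H u]; last first.
  by rewrite mem_factors right_specialE -leqNgt => /andP[/eqP/H].
have [->//|/rexts_infix uw] := eqVneq (rexts w u) [::].
by rewrite leqNgt -right_specialE H // mem_factors un eqxx.
Qed.

Lemma no_right_specialS w n : no_right_special w n -> no_right_special w n.+1.
Proof.
move=> /no_right_specialP H; apply/no_right_specialP => -[//|x u] [/H].
apply: leq_trans; apply: uniq_leq_size; [exact: uniq_rexts|exact: rexts_behead].
Qed.

Lemma surplus_eq0 w n : (surplus w n == 0) = no_right_special w n.
Proof.
rewrite /surplus sum_nat_seq_eq0 /no_right_special -all_predC.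
apply: eq_all => u /=; rewrite right_specialE.
by case: (size _) => [|[]].
Qed.

(** Removing the first letter keeps a factor right special, so a length without right special
    factors is followed only by such lengths. Positivity of [n] matters: R is positive even for a
    one-letter alphabet, where the surplus at 0 vanishes. *)
Lemma Rindex_leq w n : 0 < n -> (Rindex w <= n) = (surplus w n == 0).
Proof.
move=> n0; rewrite surplus_eq0 /Rindex; case: ex_minnP => r /andP[r0 rP] rmin.
apply/idP/idP => [rn|P]; last by apply: rmin; rewrite n0.
by rewrite -(subnK rn); elim: (n - r) => // d; apply: no_right_specialS.
Qed.

Lemma Rindex_gt0 w : 0 < Rindex w.
Proof. by rewrite /Rindex; case: ex_minnP => r /andP[]. Qed.

Lemma Rindex_leq_size w : w != [::] -> Rindex w <= size w.
Proof.
move=> w0; rewrite Rindex_leq ?surplus_eq0; last by case: w w0.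
apply/no_right_specialP => u uw.
have [->//|/rexts_ltn] := eqVneq (rexts w u) [::].
by rewrite uw ltnn.
Qed.

Lemma alph_gt0 w : w != [::] -> 0 < size (alph w).
Proof.
case: w => // x w _; have : x \in alph (x :: w) by rewrite mem_undup mem_head.
by case: (alph _).
Qed.

(** The recursion telescopes from [complexity w 1] to the value 0 at length [(size w).+1]; the
    indicators of [Kindex w <= n] sum to [(size w).+1 - Kindex w]. *)
Lemma size_surplus w : w != [::] ->
  (size w).+1 = size (alph w) + Kindex w + \sum_(1 <= n < (size w).+1) surplus w n.
Proof.
move=> w0.
have H n : n <= size w ->
    complexity w n.+1 + \sum_(1 <= i < n.+1) (Kindex w <= i : nat)
       = size (alph w) + \sum_(1 <= i < n.+1) surplus w i.
  elim: n => [|n IH] nw; first by rewrite !big_geq // complexity1.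
  rewrite !(big_nat_recr n.+1) //=.
  by have := complexity_rec nw; have := IH (ltnW nw); lia.
have := H _ (leqnn _); rewrite complexity_size_lt // sum_geq_nat.
have := Kindex_gt0 w0; have := Kindex_leq_size w.
by case: ifP; lia.
Qed.

(** Each surplus is the indicator of [n < Rindex w] plus its excess over 1. The indicators sum to R
    - 1, so the equality says that every excess vanishes. *)
Lemma size_eq_surplus w : w != [::] ->
  size w = Rindex w + Kindex w + size (alph w) - 2 <->
  forall n, 1 <= n <= size w -> surplus w n <= 1.
Proof.
move=> w0; have R0 := Rindex_gt0 w; have K0 := Kindex_gt0 w0.
have k0 := alph_gt0 w0; have RN := Rindex_leq_size w0.
have E : \sum_(1 <= n < (size w).+1) surplus w n =
    (Rindex w).-1 + \sum_(1 <= n < (size w).+1) (surplus w n).-1.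
  have -> : (Rindex w).-1 = \sum_(1 <= n < (size w).+1) (n < Rindex w : nat).
    transitivity (size w - \sum_(1 <= n < (size w).+1) (Rindex w <= n : nat)).
      by rewrite sum_geq_nat; case: ifP; lia.
    have {1}-> : size w = \sum_(1 <= n < (size w).+1) 1.
      by rewrite sum_nat_const_nat; lia.
    apply/eqP; rewrite -(eqn_add2r (\sum_(1 <= n < (size w).+1) (Rindex w <= n : nat))).
    rewrite subnK; last by apply: leq_sum => i _; exact: leq_b1.
    rewrite -big_split; apply/eqP/eq_bigr => i _ /=.
    by rewrite [i < _]ltnNge; case: (_ <= _).
  rewrite -big_split /=; apply: eq_big_nat => n /andP[n0 _].
  by rewrite ltnNge Rindex_leq //; case: (surplus w n).
have := size_surplus w0; rewrite E => S; split => [S' n nN|H].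
  have : \sum_(1 <= n < (size w).+1) (surplus w n).-1 == 0 by lia.
  rewrite sum_nat_seq_eq0 => /allP/(_ n).
  by rewrite mem_index_iota => /(_ nN) /=; lia.
suff : \sum_(1 <= n < (size w).+1) (surplus w n).-1 = 0 by lia.
rewrite big_nat_cond big1 // => n /andP[/H]; lia.
Qed.

End Extensions.

(** * Special factors and short unrepeated suffixes *)

Section UnrepeatedSuffix.

Variable T : eqType.
Implicit Types (u v w : seq T) (x y : T) (n : nat).

(** Passing through the reversed word makes the results on right extensions and [surplus] available
    for left extensions. *)
Definition left_special w u := right_special (rev w) (rev u).

Lemma left_specialI w u x y :
  x != y -> infix (x :: u) w -> infix (y :: u) w -> left_special w u.
Proof.
move=> xy xu yu; apply/right_specialP; exists x, y.
by rewrite -!rev_cons !infix_rev.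
Qed.

Lemma special_n0 w u : right_special w u -> rexts w u != [::].
Proof. by rewrite right_specialE; case: (rexts _ _). Qed.

Lemma surplus_le1_special w n u v : surplus w n <= 1 -> size u = n -> size v = n ->
  right_special w u -> right_special w v -> u = v.
Proof.
move=> S un vn su sv; apply: (sum_le1_inj S).
- by rewrite mem_factors un eqxx rexts_infix // special_n0.
- by rewrite mem_factors vn eqxx rexts_infix // special_n0.
- by move: su; rewrite right_specialE; lia.
- by move: sv; rewrite right_specialE; lia.
Qed.

Lemma surplus_le1_rexts w n u : surplus w n <= 1 -> size u = n ->
  size (rexts w u) <= 2.
Proof.
move=> S un; have [->//|/rexts_infix uw] := eqVneq (rexts w u) [::].
have := @sum_le1 _ _ _ u S; rewrite mem_factors un eqxx uw => /(_ isT); lia.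
Qed.

(** Factors of length [n] have at most two right extensions, so each factor of length [n.+1]
    contributes at most 1 and two of them are right special. Their tails are right special too,
    hence equal. *)
Lemma surplus_gt1_special w n : surplus w n.+1 > 1 -> surplus w n <= 1 ->
  exists x y u, [/\ x != y, size u = n, right_special w (x :: u)
     & right_special w (y :: u)].
Proof.
move=> S1 S0; have [||i [j [ij si sj]]] := sum_gt1_ex2 _ S1.
- exact: undup_uniq.
- case=> [|x u]; rewrite mem_factors => /andP[] // /eqP[un _].
  have := surplus_le1_rexts S0 un.
  by have := uniq_leq_size (uniq_rexts w _) (@rexts_behead _ w x u); lia.
move: si sj; rewrite !mem_factors => /andP[/eqP si _] /andP[/eqP sj _] Fi Fj.
have Ri : right_special w i by rewrite right_specialE; lia.
have Rj : right_special w j by rewrite right_specialE; lia.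
case: i ij si Ri {Fi} => // x u ij [un] Ri.
case: j ij sj Rj {Fj} => // y v ij [vn] Rj.
have beh z t : right_special w (z :: t) -> right_special w t.
  case/right_specialP=> a [b [ab /consl_infix za /consl_infix zb]].
  by apply/right_specialP; exists a, b.
have E : u = v by apply: (surplus_le1_special S0); rewrite ?(beh x u) ?(beh y v).
rewrite -{v vn}E in ij Rj; exists x, y, u; split=> //.
by apply: contra ij => /eqP->.
Qed.

Lemma infix_window w i n : infix (take n (drop i w)) w.
Proof.
exact: prefix_suffix_trans (prefix_take _ _) (suffix_drop _ _).
Qed.

Lemma window_cons x0 w i n : i < size w ->
  take n.+1 (drop i w) = nth x0 w i :: take n (drop i.+1 w).
Proof. by move=> iw; rewrite (drop_nth x0 iw). Qed.

Lemma window_shrink w i j n :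
  take n.+1 (drop i w) = take n.+1 (drop j w) -> take n (drop i w) = take n (drop j w).
Proof.
by move=> E; rewrite -(@take_takel _ n n.+1) // E take_takel.
Qed.

Lemma suffix_of_lengthS w x0 n : n < size w ->
  suffix_of_length w n.+1 = nth x0 w (size w - n.+1) :: suffix_of_length w n.
Proof.
move=> nw; rewrite /suffix_of_length (drop_nth x0) ?ltn_subrL //; last by lia.
by congr (_ :: drop _ _); lia.
Qed.

Lemma rexts_window w i n : i + n < size w -> rexts w (take n (drop i w)) != [::].
Proof.
case: w => [//|x0 w']; set w := x0 :: w' => lt.
apply: (@rexts_n0 _ _ _ (nth x0 (drop i w) n)).
rewrite -take_nth ?infix_window // size_drop; lia.
Qed.

Lemma infix_position w u : infix u w ->
  exists2 i, i + size u <= size w & take (size u) (drop i w) = u.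
Proof.
case/infixP=> p [q ->]; exists (size p); first by rewrite !size_cat; lia.
by rewrite drop_size_cat // take_size_cat.
Qed.

(** Two occurrences followed by different letters start at different positions, so one of them
    avoids [i]. *)
Lemma right_special_positions w u i : right_special w u ->
  exists j, [/\ j != i, j + size u < size w & take (size u) (drop j w) = u].
Proof.
case/right_specialP=> x [y [xy /infix_position[j]]].
rewrite size_rcons => jw jE /infix_position[k]; rewrite size_rcons => kw kE.
have red l z : take (size u).+1 (drop l w) = rcons u z ->
    take (size u) (drop l w) = u.
  move=> E; rewrite -(@take_takel _ (size u) (size u).+1) // E.
  by rewrite -cats1 take_size_cat.
have [ij|nij] := eqVneq j i; last by exists j; split; rewrite ?(red _ x) //; lia.
exists k; split; [|by lia|exact: red kE].
apply: contra xy => /eqP ki; apply/eqP.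
by move: jE; rewrite ij -ki kE => /rcons_inj[].
Qed.

(* The hypotheses give a unique left special factor u of length n, all of whose
   left extensions are right special, hence repeated.  The shortest unrepeated
   suffix is some z :: t, so t <> u and t is repeated; an occurrence of t other
   than the last one and the one at position 0 would make t left special.
   Walking to the left from the first occurrence of u and, in parallel, from a
   second occurrence of the same left extension of u, no left special factor is
   met, so t also occurs at a forbidden position. *)
Lemma no_early_unrepeated_suffix w n : 0 < n -> Kindex w = n.+1 ->
  n < Kindex (rev w) -> complexity w n.+1 = complexity w n + 1 ->
  complexity w n.+2 = complexity w n.+1 + 1 -> False.
Proof.
move=> n0 Kn Hn C1 C2; have KN := Kindex_leq_size w; rewrite Kn in KN.
have nN := ltnW KN.
(* At length [n] the K term is 0 for [w] and for [rev w], so both surpluses equal the growth 1 of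
   the complexity; at length [n.+1] the K term of [w] is 1 and the surplus is 2. *)
have S0 : surplus w n <= 1 by have := complexity_rec nN; rewrite Kn ltnn; lia.
have SL : surplus (rev w) n <= 1.
  have := @complexity_rec _ (rev w) n; rewrite size_rev !complexity_rev => /(_ nN).
  by rewrite leqNgt Hn; lia.
have S1 : 1 < surplus w n.+1 by have := complexity_rec KN; rewrite Kn leqnn; lia.
have [x [y [u [xy un sx sy]]]] := surplus_gt1_special S1 S0.
have xu := rexts_infix (special_n0 sx); have yu := rexts_infix (special_n0 sy).
have ls_uniq v : size v = n -> left_special w v -> v = u.
  move=> vn lv; apply: (can_inj revK).
  apply: (surplus_le1_special SL) => //; rewrite ?size_rev //.
  exact: left_specialI xy xu yu.
(* A third left extension of [u] beside [x] and [y] would push the surplus of [rev w] above 1. *)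
have lext z : infix (z :: u) w -> right_special w (z :: u).
  move=> zu; have [->//|zx] := eqVneq z x; have [->//|zy] := eqVneq z y.
  have : size (rexts (rev w) (rev u)) <= 2.
    by apply: surplus_le1_rexts SL _; rewrite size_rev.
  rewrite leqNgt (@size_gt2 _ _ x y z) // 1?eq_sym //;
    by rewrite mem_rexts -rev_cons infix_rev.
have {yu sx sy S0 S1 C1 C2} x0 := x.
set t := suffix_of_length w n; pose N := size w; pose fac i := take n (drop i w).
have tn : size t = n by exact: size_suffix_of_length.
have size_fac i : i + n <= N -> size (fac i) = n.
  by move=> iN; rewrite /fac size_takel // size_drop; lia.
pose z := nth x0 w (N - n.+1).
have ztE : suffix_of_length w n.+1 = z :: t by exact: suffix_of_lengthS.
have zt0 : rexts w (z :: t) = [::].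
  by apply/eqP; rewrite -ztE -Kindex_le // Kn.
have ztw : infix (z :: t) w by rewrite -ztE suffixW // suffix_suffix_of_length.
have tu : t <> u.
  by move=> E; rewrite E in ztw zt0; have := special_n0 (lext _ ztw); rewrite zt0.
have facS i : i < N -> take n.+1 (drop i w) = nth x0 w i :: fac i.+1.
  exact: window_cons.
(* Before such an occurrence of [t], the letter [z] would give [z :: t] a right extension, and any
   other letter would make [t] left special, hence equal to [u]. *)
have facP i : i.+1 + n < N -> fac i.+1 <> t.
  move=> iN E; have := @rexts_window w i n.+1; rewrite facS ?E; last by lia.
  have [zi|zi] := eqVneq (nth x0 w i) z.
    by rewrite zi zt0; rewrite addnS => /(_ iN).
  move=> _; apply: tu; apply: ls_uniq => //; apply: left_specialI zi _ ztw.
  by rewrite -E -facS ?infix_window //; lia.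
have t0 : fac 0 = t.
  have : rexts w t != [::] by rewrite -Kindex_le // Kn ltnn.
  case E : (rexts w t) => [//|c r] _.
  have : infix (rcons t c) w by rewrite -mem_rexts E mem_head.
  move=> /infix_position[i]; rewrite size_rcons tn => iN iE.
  have : fac i = t.
    by rewrite /fac -(@take_takel _ n n.+1) // iE -cats1 -tn take_size_cat.
  by case: i iN iE => // i iN _ /facP; case; rewrite /N; lia.
(* Equal windows different from [u] are not left special, so the same letter precedes both. *)
have fac_left i j : i.+1 + n <= N -> j.+1 + n <= N -> fac i.+1 = fac j.+1 ->
    fac i.+1 <> u -> fac i = fac j.
  move=> iN jN E nu; apply: window_shrink.
  rewrite !facS; [|lia|lia]; congr (_ :: _) => //.
  apply/eqP/negPn/negP => ij; apply: nu; apply: ls_uniq; first exact: size_fac.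
  by apply: left_specialI ij _ _; [rewrite -facS|rewrite E -facS];
    rewrite ?infix_window //; lia.
have ex_u : exists i, (i + n <= N) && (fac i == u).
  have [i] := infix_position (consl_infix xu).
  by rewrite un => iN iE; exists i; rewrite iN /fac iE eqxx.
case: (ex_minnP ex_u) => -[|i] /andP[iN /eqP iE] imin.
  by apply: tu; rewrite -t0.
have := @right_special_positions w (nth x0 w i :: u) i.
rewrite /= un; case.
  by apply: lext; rewrite -iE -facS ?infix_window //; lia.
move=> j [ji jN jE]; rewrite facS in jE; last by rewrite /N; lia.
case: jE => nij jE.
(* The first occurrence of [u] is at [i.+1], so the one at [j.+1] lies to its right. *)
have ij : i < j.
  have : i.+1 <= j.+1 by apply: imin; rewrite jE eqxx andbT /N; lia.
  by rewrite ltnS leq_eqVlt eq_sym (negbTE ji).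
have back d : d <= i -> fac (i - d) = fac (j - d).
  elim: d => [_|d IH di].
    rewrite !subn0; apply: window_shrink; rewrite !facS; [|rewrite /N; lia|lia].
    by rewrite nij jE iE.
  apply: fac_left.
  - lia.
  - by rewrite /N; lia.
  - have -> : (i - d.+1).+1 = i - d by lia.
    have -> : (j - d.+1).+1 = j - d by lia.
    by apply: IH; lia.
  move=> E; have := imin (i - d.+1).+1; rewrite E eqxx andbT => /(_ _); lia.
have := back i (leqnn i); rewrite subnn t0.
have -> : j - i = (j - i).-1.+1 by lia.
by move=> /esym; apply: facP; rewrite /N; lia.
Qed.

End UnrepeatedSuffix.

(** * The GT shape in terms of the surplus *)

Section HeartReduction.

Variable T : eqType.
Implicit Types (u v w : seq T) (x y : T) (n : nat).

(** For [n >= 1] the complexity now changes by the indicator of [n < Rindex w] minus that of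
    [Kindex w <= n]: by 1 below both indices, by 0 between them, by -1 from the larger one on. *)
Lemma surplus_le1_GT w : w != [::] ->
  (forall n, 1 <= n <= size w -> surplus w n <= 1) -> GT_word w.
Proof.
move=> w0 S; have [k1|k2] := leqP (size (alph w)) 1.
  by left; have := alph_gt0 w0; lia.
right; split=> //; have R0 := Rindex_gt0 w; have K0 := Kindex_gt0 w0.
have RN := Rindex_leq_size w0; have KN := Kindex_leq_size w.
have rec n : 1 <= n <= size w ->
    complexity w n.+1 + (Kindex w <= n) = complexity w n + (n < Rindex w).
  move=> nw; have /andP[n0 nN] := nw; rewrite complexity_rec //; congr (_ + _).
  have := S n nw; rewrite ltnNge Rindex_leq //.
  by case: (surplus w n) => [|[]].
exists (minn (Rindex w) (Kindex w)), (maxn (Rindex w) (Kindex w)).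
split; first by lia.
- exact: complexity0.
- case=> // i; elim: i => [|i IH] iM; first by rewrite complexity1 addn1 subn1.
  have := rec i.+1; rewrite IH; last by lia.
  lia.
- by move=> i iM; have := rec i; lia.
- by move=> i iM; have := rec i; lia.
Qed.

(** Once [m <= Kindex w], the K term vanishes for [n < m], and the recursion bounds the surplus on
    each of the three ranges of the GT shape. *)
Lemma GT_surplus_le1 w : w != [::] ->
  (uniq w \/ 1 < Kindex w /\ 1 < Kindex (rev w)) -> GT_word w ->
  forall n, 1 <= n <= size w -> surplus w n <= 1.
Proof.
move=> w0 H [k1 n nw|[k2 [m [M [mM C0 C1 C2 C3]]]]].
  suff /eqP-> : surplus w n == 0 by [].
  rewrite surplus_eq0; apply/no_right_specialP => u _.
  by rewrite -k1 uniq_leq_size ?uniq_rexts // => x; rewrite mem_filter => /andP[].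
(* This serves for whichever of [w] and [rev w] has the smaller index K: were it below [m], the
   complexity would still grow at the lengths K - 1 and K, against [no_early_unrepeated_suffix]. *)
have early v : complexity v =1 complexity w -> 1 < Kindex v <= Kindex (rev v) ->
    m <= Kindex v.
  move=> E /andP[K1 KH]; rewrite leqNgt; apply/negP => Km.
  have [n Kn] : exists n, Kindex v = n.+1 by exists (Kindex v).-1; lia.
  apply: (@no_early_unrepeated_suffix _ v n) => //; first by lia.
  - by lia.
  - by rewrite !E !C1; lia.
  - by rewrite !E !C1; lia.
have mK : m <= Kindex w.
  case: H => [uw|[K1 H1]].
    (* With distinct letters [complexity w 2] is at most [size w - 1], while [1 < m] would require
       [size w + 1]. *)
    suff : m <= 1 by have := Kindex_gt0 w0; lia.
    rewrite leqNgt; apply/negP => m1; have := C1 2; have := complexity_le w 2.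
    have -> : size (alph w) = size w by rewrite /alph undup_id.
    move: k2; rewrite /alph undup_id //; lia.
  case: (leqP (Kindex w) (Kindex (rev w))) => KH.
    by apply: early => //; lia.
  have := early (rev w) (complexity_rev w); rewrite revK; lia.
move=> n nw; have := @complexity_rec _ w n; have [nm|mn] := ltnP n m.
  by have := C1 n; have := C1 n.+1; lia.
have [nM|Mn] := ltnP n M; first by have := C2 n; lia.
by have := C3 n; lia.
Qed.

Lemma GT_sizeP w : w != [::] ->
  (uniq w \/ 1 < Kindex w /\ 1 < Kindex (rev w)) ->
  GT_word w <-> size w = Rindex w + Kindex w + size (alph w) - 2.
Proof.
move=> w0 H; split=> [G|/size_eq_surplus-/(_ w0)].
  by apply/size_eq_surplus => //; apply: GT_surplus_le1.
exact: surplus_le1_GT.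
Qed.

(** * Removing unrepeated letters from the ends *)

Lemma size_alph_rev w : size (alph (rev w)) = size (alph w).
Proof. by rewrite -!complexity1 complexity_rev. Qed.

Lemma GT_word_rev w : GT_word w -> GT_word (rev w).
Proof.
case=> [k1|[k2 [m [M [mM C0 C1 C2 C3]]]]]; [left|right]; rewrite size_alph_rev //.
split=> //; exists m, M; split=> // [|i|i|i]; rewrite ?size_rev !complexity_rev;
  by [|apply: C1|apply: C2|apply: C3].
Qed.

(** The factors of [x :: w] that contain [x] are its non-empty prefixes, one for each length. *)
Lemma complexity_cons x w n : x \notin w -> n <= size w ->
  complexity (x :: w) n.+1 = complexity w n.+1 + 1.
Proof.
move=> xw nw; rewrite addn1 -[RHS]/(size ((x :: take n w) :: factors w n.+1)).
apply/perm_size/uniq_perm; first exact: undup_uniq.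
  rewrite /= undup_uniq andbT mem_factors negb_and orbC; apply/orP; left.
  by apply: contra xw => /mem_infix; apply; rewrite mem_head.
move=> u; rewrite inE !mem_factors infix_consl prefixE andb_orr; congr (_ || _).
apply/andP/eqP => [[/eqP-> /eqP<-//]|->].
by rewrite /= size_takel // eqxx take_take.
Qed.

Lemma complexity_unary w n : size (alph w) = 1 -> n <= size w -> complexity w n = 1.
Proof.
move=> k1 nw; suff : complexity w n <= 1 by have := complexity_gt0 nw; lia.
case E : (alph w) k1 => [|a [|]] // _.
have wa x : x \in w -> x = a by rewrite -mem_undup -/(alph w) E inE => /eqP.
apply: (@uniq_leq_size _ _ [:: nseq n a]); first exact: undup_uniq.
move=> u; rewrite mem_factors inE => /andP[/eqP <- uw]; apply/eqP/all_pred1P/allP.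
by move=> x xu; apply/eqP/wa; apply: mem_infix uw _ xu.
Qed.

(** Complexity and number of letters drop together by one, so the same [m] and [M] serve. A
    one-letter [w] is GT by convention and needs explicit bounds. *)
Lemma GT_cons x w : w != [::] -> x \notin w -> GT_word (x :: w) <-> GT_word w.
Proof.
move=> w0 xw; have kS : size (alph (x :: w)) = (size (alph w)).+1.
  by rewrite /alph /= (negbTE xw).
have k0 := alph_gt0 w0; have N0 : 0 < size w by rewrite lt0n size_eq0.
have cE n : 1 <= n <= size (x :: w) -> complexity (x :: w) n = complexity w n + 1.
  by case: n => // n nw; rewrite complexity_cons //; move: nw => /=; lia.
have [k1|k2] := eqVneq (size (alph w)) 1.
  split=> [_|_]; first by left.
  right; split; first by lia.
  (* The complexity of [x :: w] is 2 at the lengths from 1 to [size w], then 1, then 0. *)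
  exists 1, (size w); split=> [||i|i|i] //.
  - exact: complexity0.
  - move=> i1; have -> : i = 1 by lia.
    by rewrite complexity1; lia.
  - by move=> iw; rewrite !cE /=; [rewrite !complexity_unary //|..]; lia.
  - move=> /= iw; have [->|iN] := eqVneq i (size w).+1.
      rewrite cE /=; last by lia.
      by rewrite !complexity_size_lt /=; lia.
    have -> : i = size w by lia.
    have := complexity_unary k1 (leqnn _); have := complexity_size_lt (ltnSn (size w)).
    by rewrite !cE /=; lia.
split=> -[|[k2' [m [M [mM C0 C1 C2 C3]]]]]; rewrite ?kS; try (by lia);
  right; (split; first by lia); exists m, M; rewrite kS in C1 k2' *.
(* The shift [cE] ends at length [(size w).+1], where [x :: w] has complexity 1; growth or constancy
   reaching that length would contradict this value. *)
- have m1 : m <= size w.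
    rewrite leqNgt; apply/negP => wm; have := C1 (size w).+1.
    by rewrite cE /= ?complexity_size_lt //; lia.
  have M1 : M <= size w.
    rewrite leqNgt; apply/negP => wm; have := C2 (size w).
    rewrite !cE /= ?(@complexity_size_lt _ _ (size w).+1) //; last by lia.
    by have := complexity_gt0 (leqnn (size w)); lia.
  split=> // [|i im|i im|i im].
  - exact: complexity0.
  - by have := C1 i; rewrite cE /=; lia.
  - by have := C2 i; rewrite !cE /=; lia.
  - by have := C3 i; rewrite /= !cE /=; lia.
have m1 : m <= size w.
  rewrite leqNgt; apply/negP => wm; have := C1 (size w).+1.
  by rewrite complexity_size_lt //; lia.
have M1 : M <= size w.
  rewrite leqNgt; apply/negP => wm; have := C2 (size w).
  rewrite (@complexity_size_lt _ _ (size w).+1) //.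
  by have := complexity_gt0 (leqnn (size w)); lia.
split=> // [|i im|i im|i /= im].
- exact: complexity0.
- by have := C1 i; rewrite cE /=; lia.
- by have := C2 i; rewrite !cE /=; lia.
(* The longer word has one more length to check, where the complexity passes from 1 to 0. *)
have [->|iN] := eqVneq i (size w).+1.
  by rewrite cE /= ?complexity_size_lt //=; lia.
by have := C3 i; rewrite !cE /=; lia.
Qed.

Lemma GT_cat p w : w != [::] -> uniq p -> ~~ has (mem w) p ->
  (GT_word (p ++ w) <-> GT_word w) /\
  size (alph (p ++ w)) = size p + size (alph w).
Proof.
move=> w0; elim: p => [|x p IH] //= /andP[xp up].
rewrite negb_or => /andP[xw hp]; have [IH1 IH2] := IH up hp.
have xpw : x \notin p ++ w by rewrite mem_cat negb_or xp.
split; last by rewrite /alph /= (negbTE xpw) /= IH2.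
rewrite -IH1; apply: GT_cons => //.
by rewrite -size_eq0 size_cat addn_eq0 negb_and !size_eq0 w0 orbT.
Qed.

Lemma GT_rcat s w : w != [::] -> uniq s -> ~~ has (mem w) s ->
  (GT_word (w ++ s) <-> GT_word w) /\
  size (alph (w ++ s)) = size s + size (alph w).
Proof.
move=> w0 us ws; have rev_iff v : GT_word v <-> GT_word (rev v).
  by split=> /GT_word_rev; rewrite ?revK.
have [||| Gs ks] := @GT_cat (rev s) (rev w).
- by rewrite -size_eq0 size_rev size_eq0.
- by rewrite rev_uniq.
- by rewrite has_rev (eq_has (mem_rev w)).
by rewrite -rev_cat -!rev_iff !size_alph_rev size_rev in Gs ks.
Qed.

(** * The letters at the ends of the heart *)

Lemma all_once_uniq w u : all (occurs_once w) u ->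
  (forall x, count_mem x u <= count_mem x w) -> uniq u.
Proof.
move=> /allP H le; apply: count_mem_uniq => x; case xu : (x \in u).
  have := le x; have /eqP-> := H x xu; have := xu; rewrite -has_pred1 has_count; lia.
by apply/count_memPn; rewrite xu.
Qed.

Lemma heart_prefix_once w : all (occurs_once w) (heart_prefix w).
Proof. by rewrite heart_prefix_longest ?heart_prefix_prefix. Qed.

Lemma heart_suffix_once w : all (occurs_once w) (heart_suffix w).
Proof. by rewrite heart_suffix_longest ?heart_suffix_suffix. Qed.

(** A letter repeated in [w] occurs neither in the removed prefix nor in the removed suffix, so all
    its occurrences lie in the heart. *)
Lemma count_heart w x : size (alph w) < size w -> x \in heart w ->
  ~~ occurs_once w x -> 1 < count_mem x (heart w).
Proof.
move=> lt xh nx; have [wE _] := heartE lt.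
have /count_memPn xp : x \notin heart_prefix w.
  by apply: contra nx; apply/allP/heart_prefix_once.
have /count_memPn xs : x \notin heart_suffix w.
  by apply: contra nx; apply/allP/heart_suffix_once.
move: xh nx; rewrite -has_pred1 has_count /occurs_once.
rewrite [in count_mem x w]wE !count_cat xp xs addn0; lia.
Qed.

(** By maximality of the removed prefix and suffix, the first and the last letter of the heart are
    repeated in [w], hence in the heart itself, so [Kindex_gt1] applies at both ends. *)
Lemma Kindex_heart w : size (alph w) < size w ->
  1 < Kindex (heart w) /\ 1 < Kindex (rev (heart w)).
Proof.
move=> lt; have [wE h0] := heartE lt.
have once_p := heart_prefix_once w.
have once_s := heart_suffix_once w.
split.
  case/lastP E : (heart w) h0 => [|v x] // _; apply: Kindex_gt1.
  have : 1 < count_mem x (heart w).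
    apply: count_heart => //; first by rewrite E mem_rcons mem_head.
    apply/negP => ox; have : suffix (x :: heart_suffix w) w.
      apply/suffixP; exists (heart_prefix w ++ v).
      by rewrite [LHS]wE E -catA cat_rcons.
    by move/heart_suffix_longest; rewrite /= ltnn ox once_s.
  by rewrite E -cats1 count_cat /= eqxx -has_pred1 has_count; lia.
case E : (heart w) h0 => [|x v] // _; rewrite rev_cons; apply: Kindex_gt1.
have : 1 < count_mem x (heart w).
  apply: count_heart => //; first by rewrite E mem_head.
  apply/negP => ox; have : prefix (rcons (heart_prefix w) x) w.
    by rewrite [X in prefix _ X]wE E -cat_rcons prefix_prefix.
  by move/heart_prefix_longest; rewrite size_rcons ltnn all_rcons ox once_p.
by rewrite E /= eqxx mem_rev -has_pred1 has_count; lia.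
Qed.

End HeartReduction.

(** * Reduction to the heart *)

Theorem theorem3p1 (T : eqType) (w : seq T) (hw : w <> [::]) :
  GT_word w <->
  size w = Rindex (heart w) + Kindex (heart w) + size (alph w) - 2.
Proof.
have w0 : w != [::] by apply/eqP.
have [lt|ge] := ltnP (size (alph w)) (size w); last first.
  have -> : heart w = w by rewrite /heart ltnNge ge.
  apply: GT_sizeP => //; left.
  by rewrite -[uniq w]negbK -ltn_size_undup -leqNgt.
have [wE h0] := heartE lt.
have once_p := heart_prefix_once w.
have once_s := heart_suffix_once w.
have count_w x : count_mem x w = count_mem x (heart_prefix w)
    + (count_mem x (heart w) + count_mem x (heart_suffix w)).
  by rewrite {1}wE !count_cat.
have [||GTs ks] := @GT_rcat _ (heart_suffix w) (heart w) h0.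
- by apply: all_once_uniq once_s _ => x; rewrite count_w; lia.
- apply/hasPn => x xs; have /eqP := allP once_s x xs.
  by rewrite count_w /= -!has_pred1 !has_count in xs *; lia.
have [|||GTp kp] := @GT_cat _ (heart_prefix w) (heart w ++ heart_suffix w).
- by rewrite -size_eq0 size_cat addn_eq0 negb_and !size_eq0 h0.
- by apply: all_once_uniq once_p _ => x; rewrite count_w; lia.
- apply/hasPn => x xp; have /eqP := allP once_p x xp.
  by rewrite count_w /= mem_cat -!has_pred1 !has_count in xp *; lia.
rewrite -wE in GTp kp; rewrite GTp GTs GT_sizeP //; last first.
  by right; apply: Kindex_heart.
have sw : size w = size (heart_prefix w) + (size (heart w) + size (heart_suffix w)).
  by rewrite {1}wE !size_cat.
(* Passing to the heart lowers length and number of letters equally; the positivity facts keep the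
   subtraction of 2 from truncating. *)
have := Rindex_gt0 (heart w); have := Kindex_gt0 h0; have := alph_gt0 h0; lia.
Qed.
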